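(* Let $n,k,\ell$ be integers with $1\le k\le n$ and $\ell\ge 0$. There exists a (randomized) algorithm that solves the $\ell$-bounded error partition learning problem on $V=[n]$ for hidden partitions into $k$ clusters and makes at most $$ (\ell+1)\left( \frac{n(k+1)}{2} - k \right) + \ell $$ queries in expectation (over the algorithm's internal randomness), both when $k$ is known to the algorithm and when it is not.
   Context: Given a partition $\mathcal{C}$ of a finite set $V$, the same-cluster oracle $\alpha_{\mathcal{C}}$ takes a pair $\{u,v\}$ of distinct elements of $V$ and returns $1$ if $u,v$ lie in the same cluster of $\mathcal{C}$ and $-1$ otherwise. An $\ell$-faulty same-cluster oracle may return an incorrect answer on at most $\ell$ of the queries made over the whole run; errors may be chosen adversarially and are not persistent (repeating a query may give different answers). The $\ell$-bounded error partition learning problem is: given $V$ and access to an $\ell$-faulty same-cluster oracle for an unknown partition $\mathcal{C}$ of $V$ into $k$ nonempty clusters, always exactly recover $\mathcal{C}$. The expectation bound holds for every hidden partition and every admissible oracle behavior. *)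

(* Defs.v *)
From mathcomp Require Import all_boot all_order all_algebra.

Set Implicit Arguments.
Unset Strict Implicit.
Unset Printing Implicit Defensive.

Import GRing.Theory Num.Theory.
Local Open Scope ring_scope.

(* [partition] already forces every cluster to be nonempty. *)
Definition clustering (n k : nat) (C : {set {set 'I_n}}) : Prop :=
  partition C [set: 'I_n] /\ #|C| = k.

(* A query is an unordered pair of distinct elements. *)
Definition query (n : nat) : Type := {e : {set 'I_n} | #|e| == 2%N}.

(* Oracle answers are booleans: [true] stands for 1, [false] for -1. *)
Definition same_cluster (n : nat) (C : {set {set 'I_n}}) (q : query n) : bool :=
  [exists B in C, val q \subset B].

(* Chronological list of the queries made so far and the answers received. *)
Definition history (n : nat) : Type := seq (query n * bool).

(* An answer may depend on the whole past interaction, so the oracle can be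
   adaptive, and a repeated query need not receive the same answer. *)
Definition oracle (n : nat) : Type := history n -> query n -> bool.

Inductive det_alg (n : nat) : Type :=
| Output of {set {set 'I_n}}
| Ask of query n & (bool -> det_alg n).

Fixpoint run_from (n : nat) (O : oracle n) (h : history n) (t : det_alg n) :
    {set {set 'I_n}} * history n :=
  match t with
  | Output P => (P, h)
  | Ask q next => let a := O h q in run_from O (rcons h (q, a)) (next a)
  end.

Definition output (n : nat) (O : oracle n) (t : det_alg n) : {set {set 'I_n}} :=
  (run_from O [::] t).1.

Definition transcript (n : nat) (O : oracle n) (t : det_alg n) : history n :=
  (run_from O [::] t).2.

Definition num_queries (n : nat) (O : oracle n) (t : det_alg n) : nat :=
  size (transcript O t).

Definition num_errors (n : nat) (C : {set {set 'I_n}}) (O : oracle n)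
    (t : det_alg n) : nat :=
  count (fun qa : query n * bool => qa.2 != same_cluster C qa.1)
    (transcript O t).

(* A randomized algorithm draws a seed once and for all and then runs the
   deterministic algorithm attached to that seed; the oracle does not see
   the seed. *)
Record rand_alg (R : realFieldType) (n : nat) : Type := RandAlg {
  seed : finType;
  prob : seed -> R;
  prob_ge0 : forall s, 0 <= prob s;
  prob_sum1 : \sum_s prob s = 1;
  det_of : seed -> det_alg n
}.

Definition expected_queries (R : realFieldType) (n : nat) (A : rand_alg R n)
    (O : oracle n) : R :=
  \sum_(s : seed A) prob s * (num_queries O (det_of s))%:R.

Definition faulty_for (R : realFieldType) (n l : nat) (A : rand_alg R n)
    (C : {set {set 'I_n}}) (O : oracle n) : Prop :=
  forall s : seed A, (num_errors C O (det_of s) <= l)%N.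

Definition solves (R : realFieldType) (n k l : nat) (A : rand_alg R n) : Prop :=
  forall C : {set {set 'I_n}}, clustering k C ->
  forall (O : oracle n) (s : seed A),
    (num_errors C O (det_of s) <= l)%N -> output O (det_of s) = C.

Definition expected_queries_le (R : realFieldType) (n k l : nat)
    (A : rand_alg R n) (b : R) : Prop :=
  forall C : {set {set 'I_n}}, clustering k C ->
  forall O : oracle n, faulty_for l A C O -> expected_queries A O <= b.

Definition query_bound (R : realFieldType) (n k l : nat) : R :=
  (l%:R + 1) * (n%:R * (k%:R + 1) / 2 - k%:R) + l%:R.

(* Main.v *)
(* Without errors: process the elements in a uniformly random order; the first
   remaining element is compared with all other remaining ones, which reveals
   its cluster, and the cluster is removed. The ordered pair (u, v) is queried
   exactly when u is the first element of cl(u) :|: cl(v), so with probability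
   1 / #|cl(u) :|: cl(v)|; summing, with 1 / (a + b) <= (1 / a + 1 / b) / 4 for
   distinct clusters of sizes a and b, gives at most n (k + 1) / 2 - k.
   With at most l errors: repeat each query until some answer has occurred l + 1
   times. That answer is correct, and the query costs l + 1 plus the number of
   errors spent on it, so that all errors together cost at most l. *)
Require Import Defs.
From mathcomp Require Import all_boot all_order all_algebra.
From mathcomp Require Import fingroup perm zify ring lra.

Set Implicit Arguments.
Unset Strict Implicit.
Unset Printing Implicit Defensive.

Import Order.TTheory GRing.Theory Num.Theory.

(** * Simulating an error-free run against a faulty oracle *)

Fixpoint truth_output n (C : {set {set 'I_n}}) (t : det_alg n) :=
  match t with
  | Output P => P
  | Ask q next => truth_output C (next (same_cluster C q))
  end.

Fixpoint truth_cost n (C : {set {set 'I_n}}) (t : det_alg n) : nat :=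
  match t with
  | Output _ => 0
  | Ask q next => (truth_cost C (next (same_cluster C q))).+1
  end.

(* Asks [q] until it has received [i.+1] positive or [j.+1] negative answers. *)
Fixpoint vote n (q : query n) (next : bool -> det_alg n) (i : nat) :
    nat -> det_alg n :=
  fix vote_no (j : nat) : det_alg n :=
    Ask q (fun a =>
      if a then (if i is i'.+1 then vote q next i' j else next true)
      else (if j is j'.+1 then vote_no j' else next false)).

Fixpoint amplify n (l : nat) (t : det_alg n) : det_alg n :=
  match t with
  | Output P => Output P
  | Ask q next => vote q (fun a => amplify l (next a)) l l
  end.

Definition errors n (C : {set {set 'I_n}}) (h : history n) : nat :=
  count (fun qa : query n * bool => qa.2 != same_cluster C qa.1) h.

Lemma errors_cat n (C : {set {set 'I_n}}) (h1 h2 : history n) :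
  errors C (h1 ++ h2) = errors C h1 + errors C h2.
Proof. exact: count_cat. Qed.

Lemma run_from_extends n (O : oracle n) (t : det_alg n) (h : history n) :
  exists e, (run_from O h t).2 = h ++ e.
Proof.
elim: t h => [P|q next IH] h /=; first by exists [::]; rewrite cats0.
have [e ->] := IH (O h q) (rcons h (q, O h q)).
by exists ((q, O h q) :: e); rewrite cat_rcons.
Qed.

(** Here [e] holds the answers spent on the vote. If the truth wins, its counter is used up and
    every other answer is an error; if it loses, the wrong answers alone exhaust their counter.
    Arbitrary [i] and [j] make the induction possible. *)
Lemma run_vote n (C : {set {set 'I_n}}) (O : oracle n) (q : query n)
    (next : bool -> det_alg n) i j h (c := same_cluster C q) :
  exists e a, run_from O h (vote q next i j) = run_from O (h ++ e) (next a) /\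
    (a = c /\ size e = (if c then i else j).+1 + errors C e \/
     (if c then j else i) < errors C e).
Proof.
(* Each answer lowers one of the two counters, so their sum decreases. *)
have [m] := ubnP (i + j); elim: m i j h => // m IH i j h ijm.
(* The nested fixpoints reduce only on constructors, hence this unfolding by cases. *)
have -> : vote q next i j = Ask q (fun a =>
    if a then (if i is i'.+1 then vote q next i' j else next true)
    else (if j is j'.+1 then vote q next i j' else next false)).
  by case: (i) (j) => [|?] [|?].
rewrite /=; case: (O h q).
- case: i ijm => [|i] ijm.
    exists [:: (q, true)], true; rewrite cats1 /errors /= -/c; split=> //.
    by case: (c); [left|right].
  have [|e [a [-> H]]] := IH i j (rcons h (q, true)); first by lia.
  exists ((q, true) :: e), a; rewrite cat_rcons; split=> //.
  rewrite /errors /= -/c -/(errors C e); move: H.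
  by case: (c) => -[[-> H]|H]; (by left; split => //=; lia) || (by right; lia).
- case: j ijm => [|j] ijm.
    exists [:: (q, false)], false; rewrite cats1 /errors /= -/c; split=> //.
    by case: (c); [right|left].
  have [|e [a [-> H]]] := IH i j (rcons h (q, false)); first by lia.
  exists ((q, false) :: e), a; rewrite cat_rcons; split=> //.
  rewrite /errors /= -/c -/(errors C e); move: H.
  by case: (c) => -[[-> H]|H]; (by left; split => //=; lia) || (by right; lia).
Qed.

(** A lost vote would contain more than [l] errors, so every vote returns the truth and the run
    follows the error-free branch. Errors add up over the votes, so their cost is not multiplied by
    the number of simulated queries. *)
Lemma run_amplify n l (C : {set {set 'I_n}}) (O : oracle n) t h :
  errors C (run_from O h (amplify l t)).2 <= l ->
  exists e, [/\ run_from O h (amplify l t) = (truth_output C t, h ++ e) &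
    size e = l.+1 * truth_cost C t + errors C e].
Proof.
elim: t h => [P|q next IH] h /= le_l.
  by exists [::]; rewrite cats0 muln0.
have [e [a [E H]]] := run_vote C O q (fun a => amplify l (next a)) l l h.
rewrite E in le_l *.
case: H => [[a_c size_e]|]; last first.
  rewrite if_same => gt_l.
  (* Later queries only extend the history, so the errors of a lost vote stay in the final count. *)
  have [e' E'] := run_from_extends O (amplify l (next a)) (h ++ e).
  by move: le_l; rewrite E' !errors_cat; lia.
rewrite if_same in size_e; subst a.
have [e' [-> size_e']] := IH _ _ le_l.
exists (e ++ e'); rewrite catA; split=> //.
by rewrite size_cat errors_cat size_e size_e' mulnS; lia.
Qed.

Lemma output_amplify n l (C : {set {set 'I_n}}) (O : oracle n) t :
  num_errors C O (amplify l t) <= l ->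
  output O (amplify l t) = truth_output C t.
Proof. by move=> /run_amplify [e [E _]]; rewrite /output E. Qed.

Lemma num_queries_amplify n l (C : {set {set 'I_n}}) (O : oracle n) t :
  num_errors C O (amplify l t) <= l ->
  num_queries O (amplify l t) <= l.+1 * truth_cost C t + l.
Proof.
move=> le_l; have [e [E size_e]] := run_amplify le_l.
move: le_l; rewrite /num_errors /num_queries /transcript E /= size_e.
by rewrite -/(errors C e) leq_add2l.
Qed.

(** * The pivot algorithm and its correctness *)

(* No query is needed when [u = v]. *)
Definition ask_same n (u v : 'I_n) (next : bool -> det_alg n) : det_alg n :=
  if insub [set u; v] is Some q then Ask q next else next true.

(** Continuation-passing style: the rest of the decision tree is built from the two lists [yes] and
    [no]. *)
Fixpoint split_cluster n (x : 'I_n) (r : seq 'I_n)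
    (next : seq 'I_n -> seq 'I_n -> det_alg n) : det_alg n :=
  if r is v :: r' then
    ask_same x v (fun b => split_cluster x r' (fun yes no =>
      if b then next (v :: yes) no else next yes (v :: no)))
  else next [::] [::].

(* [m] is fuel: [size s] is enough. *)
Fixpoint pivot_learn n (m : nat) (s : seq 'I_n) (P : {set {set 'I_n}}) :
    det_alg n :=
  if m is m'.+1 then
    if s is x :: r then
      split_cluster x r (fun yes no =>
        pivot_learn m' no ([set y in x :: yes] |: P))
    else Output P
  else Output P.

Lemma same_cluster_pair n (C : {set {set 'I_n}}) (q : query n) u v :
  partition C [set: 'I_n] -> val q = [set u; v] ->
  same_cluster C q = (pblock C u == pblock C v).
Proof.
move=> partC qE; have tI := partition_trivIset partC.
have covC w : w \in cover C by rewrite (cover_partition partC) inE.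
rewrite /same_cluster qE; apply/exists_inP/eqP => [[B BC]|uv].
  rewrite subUset !sub1set => /andP[uB vB].
  by rewrite !(def_pblock tI BC).
exists (pblock C u); first exact: pblock_mem.
by rewrite subUset !sub1set {2}uv !mem_pblock !covC.
Qed.

Lemma truth_ask_same n (C : {set {set 'I_n}}) u v next
    (b := pblock C u == pblock C v) : partition C [set: 'I_n] ->
  truth_output C (ask_same u v next) = truth_output C (next b) /\
  truth_cost C (ask_same u v next) = (u != v) + truth_cost C (next b).
Proof.
move=> partC; rewrite /ask_same; case: insubP => /= [q|].
  rewrite cards2 => uv qE; rewrite (same_cluster_pair partC qE) -/b.
  by case: (u != v) uv.
rewrite cards2; have [uv _|//] := eqVneq u v.
by rewrite /b uv eqxx.
Qed.

Lemma truth_split_cluster n (C : {set {set 'I_n}}) x r next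
    (p := fun v => pblock C x == pblock C v) :
  partition C [set: 'I_n] -> x \notin r ->
  let t := next (filter p r) (filter (predC p) r) in
  truth_output C (split_cluster x r next) = truth_output C t /\
  truth_cost C (split_cluster x r next) = size r + truth_cost C t.
Proof.
move=> partC; elim: r next => [//|v r IH] next.
rewrite inE negb_or => /andP[xv xr].
rewrite [split_cluster _ _ _]/=; set k := (k in ask_same x v k).
have [-> ->] := truth_ask_same x v k partC.
rewrite xv /k; have [-> ->] := IH (fun yes no =>
  if p v then next (v :: yes) no else next yes (v :: no)) xr.
by rewrite /= /p; case: eqP.
Qed.

(** The last hypothesis says that [s] is a union of clusters. Hence the pivot finds its whole
    cluster in [s], and what remains is again a union of clusters. *)
Lemma truth_output_pivot_learn n (C : {set {set 'I_n}}) m s P :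
  partition C [set: 'I_n] -> uniq s -> size s <= m ->
  (forall u v, pblock C u = pblock C v -> u \in s -> v \in s) ->
  truth_output C (pivot_learn m s P) = [set pblock C y | y in s] :|: P.
Proof.
move=> partC; have tI := partition_trivIset partC.
have covC w : w \in cover C by rewrite (cover_partition partC) inE.
have nilE Q : Q = [set pblock C y | y in [::]] :|: Q.
  by apply/setP=> B; rewrite inE; case: imsetP => // -[].
elim: m s P => [|m IH] [|x r] Q /=; [by move=> *; exact: nilE|by case/andP|by move=> *; exact: nilE|].
move=> /andP[xr ur] le_m closed.
set next := (k in split_cluster x r k).
have [-> _] := truth_split_cluster next partC xr.
rewrite /next IH ?filter_uniq //; first last.
- move=> u v uv; rewrite !mem_filter /= -uv => /andP[xu ur'].
  have : v \in x :: r by apply: (closed u); rewrite // inE ur' orbT.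
  by rewrite inE xu; have [vx|//] := eqVneq v x; rewrite -vx uv eqxx in xu.
- by rewrite size_filter; apply: leq_trans (count_size _ _) _.
have -> : [set y in x :: [seq v <- r | pblock C x == pblock C v]] = pblock C x.
  apply/setP=> y; rewrite inE in_cons mem_filter.
  have [->|yx] := eqVneq y x; first by rewrite mem_pblock covC.
  rewrite -eq_pblock //=; case: eqP => //= xy.
  by have := closed x y xy (mem_head _ _); rewrite inE (negPf yx).
rewrite setUA; congr (_ :|: Q); apply/setP=> B; rewrite !inE.
apply/orP/imsetP => [[/imsetP[y]|/eqP->]|[y]].
- by rewrite mem_filter => /andP[_ yr] ->; exists y => //; rewrite inE yr orbT.
- by exists x; rewrite ?mem_head.
- rewrite inE => /orP[/eqP->|yr] ->; first by right.
  have [->|xy] := eqVneq (pblock C x) (pblock C y); first by right.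
  by left; apply/imsetP; exists y; rewrite // mem_filter /= xy.
Qed.

(** * The error-free cost as a sum over ordered pairs *)

Definition first_among n (C : {set {set 'I_n}}) (s : seq 'I_n) (u v : 'I_n) :=
  ohead [seq w <- s | pblock C w \in [:: pblock C u; pblock C v]] == Some u.

Lemma first_among_cons n (C : {set {set 'I_n}}) x s u v :
  first_among C (x :: s) u v =
  if pblock C x \in [:: pblock C u; pblock C v] then x == u
  else first_among C s u v.
Proof. by rewrite /first_among /=; case: ifP. Qed.

(** Removing a third cluster does not change which element comes first in the clusters of [u] and
    [v]; this carries the count through the recursion. *)
Lemma first_among_filter n (C : {set {set 'I_n}}) x s u v
    (p := fun w => pblock C x != pblock C w) :
  p u -> p v -> first_among C (filter p s) u v = first_among C s u v.
Proof.
rewrite /p => pu pv; rewrite /first_among -filter_predI.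
congr (ohead _ == _); apply: eq_filter => w /=.
rewrite !inE /p; case: (_ =P pblock C u) => [->|_]; first by rewrite pu.
by case: (_ =P pblock C v) => [->|_]; rewrite ?pv.
Qed.

Lemma truth_cost_pivot_learn n (C : {set {set 'I_n}}) m s P :
  partition C [set: 'I_n] -> uniq s -> size s <= m ->
  truth_cost C (pivot_learn m s P) =
  \sum_(u <- s) \sum_(v <- s | v != u) first_among C s u v.
Proof.
move=> partC; elim: m s P => [|m IH] [|x r] Q /=;
  [by rewrite big_nil|by case/andP|by rewrite big_nil|].
move=> /andP[xr ur] le_m.
set next := (k in split_cluster x r k).
have [_ ->] := truth_split_cluster next partC xr.
rewrite /next IH ?filter_uniq //; last first.
  by rewrite size_filter; apply: leq_trans (count_size _ _) _.
(* The row of the pivot [x]: it precedes everything, so each element of [r] counts once. *)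
rewrite big_cons; congr (_ + _).
  rewrite big_cons eqxx /= -sum1_size; symmetry.
  rewrite big_seq_cond [RHS]big_seq; apply: eq_big => v.
    by case vr: (v \in r) => //=; apply: contraNneq xr => <-.
  by move=> _; rewrite first_among_cons mem_head eqxx.
rewrite big_filter [RHS]big_seq [RHS](bigID (fun u => pblock C x != pblock C u)) /=.
(* Rows of the other elements in the cluster of [x] vanish, since [x] precedes them. *)
rewrite [X in _ = _ + X]big1 ?addn0; last first.
  move=> u /andP[ur']; rewrite negbK => /eqP xu; rewrite big1 // => v _.
  rewrite first_among_cons xu mem_head; case: eqP => // ux.
  by rewrite ux ur' in xr.
rewrite [LHS]big_seq_cond; apply: eq_bigr => u /andP[ur' xu].
rewrite big_filter_cond big_cons /= first_among_cons !inE (negPf xu) /=.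
case: ifP => [_|/negbFE/eqP xu']; last by rewrite xu' ur' in xr.
have -> : (x == u) = false by apply: contraNF xr => /eqP->.
rewrite eqxx add0n.
rewrite [RHS](bigID (fun v => pblock C x != pblock C v)) /=.
(* Likewise for [v] in the cluster of [x]: then [x], not [u], comes first. *)
rewrite [X in _ = _ + X]big1 ?addn0; last first.
  move=> v /andP[vu]; rewrite negbK => /eqP xv.
  rewrite first_among_cons xv !inE eqxx orbT; case: eqP => // xu'.
  by rewrite xu' ur' in xr.
apply: eq_big => [v|v /andP[xv vu]]; first by rewrite andbC.
by rewrite first_among_filter // first_among_cons !inE (negPf xu) (negPf xv).
Qed.

Local Open Scope ring_scope.

(** * Uniformly random orders *)

Definition order_of n (s : 'S_n) : seq 'I_n := [seq s i | i <- enum 'I_n].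

Lemma order_of_uniq n (s : 'S_n) : uniq (order_of s).
Proof. by rewrite map_inj_uniq ?enum_uniq //; apply: perm_inj. Qed.

Lemma mem_order_of n (s : 'S_n) u : u \in order_of s.
Proof. by apply/mapP; exists (s^-1 u)%g; rewrite ?mem_enum ?permKV. Qed.

Lemma size_order_of n (s : 'S_n) : size (order_of s) = n.
Proof. by rewrite size_map size_enum_ord. Qed.

(* By symmetry under transpositions inside [S], each element of [S] comes
   first in [S] for the same number of orders. *)
Lemma sum_ohead_order n (S : {set 'I_n}) u : u \in S ->
  (#|S| * \sum_(s : 'S_n) (ohead [seq w <- order_of s | w \in S] == Some u)
    <= n`!)%N.
Proof.
move=> uS; pose N w := (\sum_(s : 'S_n)
  (ohead [seq w <- order_of s | w \in S] == Some w))%N.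
have N_const w : w \in S -> N w = N u.
  move=> wS; rewrite /N (reindex_inj (mulIg (tperm u w))) /=.
  apply: eq_bigr => s _.
  have -> : order_of (s * tperm u w)%g = map (tperm u w) (order_of s).
    by rewrite -map_comp; apply: eq_map => i; rewrite permM.
  rewrite filter_map.
  have -> : [seq i <- order_of s | preim (tperm u w) (mem S) i] =
            [seq i <- order_of s | i \in S].
    by apply: eq_filter => i /=; case: tpermP => [->|->|//]; rewrite uS wS.
  case: [seq i <- _ | _] => [|y r] //=; congr nat_of_bool.
  by rewrite !(inj_eq Some_inj) (can2_eq (tpermK u w) (tpermK u w)) tpermR.
rewrite -/(N u) -sum_nat_const -(eq_bigr (fun=> N u) N_const) /N exchange_big /=.
(* Double counting: an order has at most one first element in [S], so it contributes at most 1. *)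
rewrite -card_Sn -sum1_card; apply: leq_sum => s _.
case: (ohead _) => [y|]; last by rewrite big1.
rewrite (bigID (pred1 y)) /= [X in (_ + X)%N]big1 => [|i /andP[_ iy]]; last first.
  by rewrite /eq_op /= eq_sym (negPf iy).
rewrite addn0; have [yS|yS] := boolP (y \in S).
  rewrite (big_pred1 y) ?leq_b1 // => i /=.
  by case: eqP => [->|]; rewrite ?andbF ?yS.
by rewrite big_pred0 // => i /=; case: eqP => [->|]; rewrite ?andbF // (negPf yS).
Qed.

(** * Summing the query probabilities over all pairs *)

Definition two_clusters n (C : {set {set 'I_n}}) (u v : 'I_n) : {set 'I_n} :=
  [set w | pblock C w \in [:: pblock C u; pblock C v]].

Lemma two_clusters_gt0 n (C : {set {set 'I_n}}) u v :
  (0 < #|two_clusters C u v|)%N.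
Proof. by apply/card_gt0P; exists u; rewrite inE mem_head. Qed.

Lemma sum_first_among (R : realFieldType) n (C : {set {set 'I_n}}) u v :
  (\sum_(s : 'S_n) first_among C (order_of s) u v)%:R <=
  n`!%:R / #|two_clusters C u v|%:R :> R.
Proof.
rewrite ler_pdivlMr ?ltr0n ?two_clusters_gt0 // -natrM ler_nat mulnC.
apply: leq_trans (sum_ohead_order (S := two_clusters C u v) (u := u) _); last first.
  by rewrite inE mem_head.
rewrite leq_mul2l; apply/orP; right; apply: leq_sum => s _.
rewrite /first_among.
by under [in X in (_ <= X)%N]eq_filter => w do rewrite inE.
Qed.

(** A cluster [B] contributes [#|B|] terms equal to [1 / #|B|], that is 1. *)
Lemma sum_inv_card_pblock (R : realFieldType) n k (C : {set {set 'I_n}}) :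
  clustering k C -> \sum_u #|pblock C u|%:R^-1 = k%:R :> R.
Proof.
move=> [partC <-]; rewrite -sumr_const.
have tI := partition_trivIset partC.
transitivity (\sum_(u in [set: 'I_n]) #|pblock C u|%:R^-1 : R).
  by apply: eq_bigl => u; rewrite inE.
rewrite -(cover_partition partC) big_trivIset //=; apply: eq_bigr => B BC.
have B0 : #|B| != 0%N by apply: contraTneq BC => /cards0_eq ->; case/and3P: partC.
transitivity (\sum_(u in B) #|B|%:R^-1 : R).
  by apply: eq_bigr => u uB; rewrite (def_pblock tI BC uB).
by rewrite sumr_const -[RHS](mulVf (x := #|B|%:R : R)) ?pnatr_eq0 // mulr_natr.
Qed.

Lemma card_pblock_gt0 n (C : {set {set 'I_n}}) u :
  partition C [set: 'I_n] -> (0 < #|pblock C u|)%N.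
Proof.
move=> partC; apply/card_gt0P; exists u.
by rewrite mem_pblock (cover_partition partC) inE.
Qed.

Lemma pblock_fiber n (C : {set {set 'I_n}}) u :
  partition C [set: 'I_n] -> [set w | pblock C w == pblock C u] = pblock C u.
Proof.
move=> partC; apply/setP=> w; rewrite inE eq_sym eq_pblock //.
  exact: partition_trivIset partC.
by rewrite (cover_partition partC) inE.
Qed.

Lemma card_two_clusters n (C : {set {set 'I_n}}) u v :
  partition C [set: 'I_n] ->
  #|two_clusters C u v| = if pblock C u == pblock C v then #|pblock C u|
                          else (#|pblock C u| + #|pblock C v|)%N.
Proof.
move=> partC.
have -> : two_clusters C u v = pblock C u :|: pblock C v.
  by apply/setP=> w; rewrite -(pblock_fiber u) // -(pblock_fiber v) // !inE.
case: eqP => [->|/eqP uv]; first by rewrite setUid.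
rewrite cardsU (_ : _ :&: _ = set0) ?cards0 ?subn0 //; apply/setP=> w.
rewrite -(pblock_fiber u) // -(pblock_fiber v) // !inE.
by case: eqP => //= ->; apply: negbTE.
Qed.

(** One formula for both cases, ready to be summed: the conditional term makes it an equality inside
    a single cluster. *)
Lemma inv_card_two_clusters_le (R : realFieldType) n (C : {set {set 'I_n}}) u v :
  partition C [set: 'I_n] ->
  #|two_clusters C u v|%:R^-1 <=
    (#|pblock C u|%:R^-1 + #|pblock C v|%:R^-1) / 4
    + (if pblock C v == pblock C u then #|pblock C u|%:R^-1 / 2 else 0) :> R.
Proof.
move=> partC; rewrite card_two_clusters // eq_sym.
have a0 : 0 < #|pblock C u|%:R :> R by rewrite ltr0n card_pblock_gt0.
have b0 : 0 < #|pblock C v|%:R :> R by rewrite ltr0n card_pblock_gt0.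
case: eqP => [->|_]; first by lra.
rewrite natrD addr0; set a := (X in X + _) in a0 *; set b := (X in _ + X) in b0 *.
rewrite -subr_ge0.
(* The gap between harmonic and arithmetic means, as an explicit square. *)
have -> : (a^-1 + b^-1) / 4 - (a + b)^-1 = (a - b) ^+ 2 / (4 * a * b * (a + b)).
  by field; rewrite !gt_eqF // addr_gt0.
by rewrite divr_ge0 ?sqr_ge0 // !mulr_ge0 ?addr_ge0 ?ltW.
Qed.

Lemma sum_inv_card_le (R : realFieldType) n k (C : {set {set 'I_n}}) :
  clustering k C ->
  \sum_u \sum_(v | v != u) #|two_clusters C u v|%:R^-1
  <= n%:R * (k%:R + 1) / 2 - k%:R :> R.
Proof.
move=> Ck; have [partC _] := Ck; have sumE := sum_inv_card_pblock R Ck.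
pose a u : R := #|pblock C u|%:R.
pose f u v := ((a u)^-1 + (a v)^-1) / 4
    + (if pblock C v == pblock C u then (a u)^-1 / 2 else 0).
(* The inner sum is completed with [v = u], where [f u u] is [(a u)^-1]; subtracting these terms
   yields the final [- k]. *)
apply: (@le_trans _ _ (\sum_u (\sum_v f u v - (a u)^-1))).
  apply: ler_sum => u _; rewrite [\sum_v f u v](bigD1 u) //= [f u u]/f eqxx.
  rewrite addrC; set x := \sum_(i | i != u) f u i.
  apply: (@le_trans _ _ x); last by lra.
  by apply: ler_sum => v _; apply: inv_card_two_clusters_le.
(* The [1 / 2] comes from the [a u] elements of the cluster of [u], each adding [(a u)^-1 / 2]. *)
have rowE u : \sum_v f u v = n%:R * (a u)^-1 / 4 + k%:R / 4 + 1 / 2.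
  rewrite /f big_split /= -mulr_suml big_split /= sumr_const card_ord sumE.
  rewrite -mulr_natl -big_mkcond /= sumr_const.
  have -> : #|[pred v | pblock C v == pblock C u]| = #|pblock C u|.
    by rewrite -[in RHS]pblock_fiber // cardsE.
  have au0 : a u != 0 by rewrite pnatr_eq0 -lt0n card_pblock_gt0.
  by rewrite -[_ *+ _]mulr_natl -/(a u); field.
under eq_bigr => u _ do rewrite rowE.
rewrite sumrB sumE !big_split /= !sumr_const card_ord -!mulr_suml -mulr_sumr sumE.
by rewrite -(mulr_natl (k%:R / 4)) -(mulr_natl (1 / 2)); lra.
Qed.

(** * The randomized algorithm and its expected cost *)

Lemma uniform_sum1 (R : realFieldType) n :
  \sum_(s : 'S_n) (n`!%:R)^-1 = 1 :> R.
Proof.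
by rewrite sumr_const card_Sn -[LHS]mulr_natr mulVf // pnatr_eq0 -lt0n fact_gt0.
Qed.

Lemma uniform_ge0 (R : realFieldType) n (s : 'S_n) : 0 <= (n`!%:R)^-1 :> R.
Proof. by rewrite invr_ge0 ler0n. Qed.

Definition robust_pivot (R : realFieldType) n l : rand_alg R n :=
  RandAlg (@uniform_ge0 R n) (@uniform_sum1 R n)
    (fun s => amplify l (pivot_learn n (order_of s) set0)).

Lemma solves_robust_pivot (R : realFieldType) n k l :
  solves k l (robust_pivot R n l).
Proof.
move=> C [partC _] O s le_l; rewrite (output_amplify le_l).
rewrite truth_output_pivot_learn ?order_of_uniq ?size_order_of //; last first.
  by move=> *; apply: mem_order_of.
rewrite setU0; apply/setP=> B; apply/imsetP/idP => [[y _ ->]|BC].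
  by rewrite pblock_mem // (cover_partition partC) inE.
have [y yB] : exists y, y \in B.
  by apply/set0Pn; apply: contraTneq BC => ->; case/and3P: partC.
exists y; first exact: mem_order_of.
by rewrite (def_pblock (partition_trivIset partC) BC yB).
Qed.

Lemma sum_truth_cost_le (R : realFieldType) n k (C : {set {set 'I_n}}) P :
  clustering k C ->
  \sum_(s : 'S_n) (n`!%:R)^-1 * (truth_cost C (pivot_learn n (order_of s) P))%:R
  <= n%:R * (k%:R + 1) / 2 - k%:R :> R.
Proof.
move=> Ck; have [partC _] := Ck; apply: le_trans (sum_inv_card_le R Ck).
have sum_order s (F : 'I_n -> nat) (p : pred 'I_n) :
    (\sum_(u <- order_of s | p u) F u = \sum_(u | p u) F u)%N.
  apply: perm_big; apply: uniq_perm.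
  - exact: order_of_uniq.
  - exact: index_enum_uniq.
  - by move=> u; rewrite mem_order_of mem_index_enum.
rewrite -mulr_sumr mulrC ler_pdivrMr ?ltr0n ?fact_gt0 // -natr_sum.
under eq_bigr => s _.
  rewrite truth_cost_pivot_learn ?order_of_uniq ?size_order_of // sum_order.
  under eq_bigr => u _ do rewrite sum_order.
  over.
(* The sum over orders moves inside, so that each pair is bounded separately. *)
rewrite exchange_big natr_sum mulr_suml; apply: ler_sum => u _.
rewrite exchange_big natr_sum mulr_suml; apply: ler_sum => v _.
by rewrite mulrC sum_first_among.
Qed.

Lemma expected_robust_pivot (R : realFieldType) n k l :
  expected_queries_le k l (robust_pivot R n l) (query_bound R n k l).
Proof.
move=> C Ck O faulty; rewrite /expected_queries /query_bound /=.
apply: (@le_trans _ _ (\sum_(s : 'S_n) (n`!%:R)^-1 *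
    (l.+1 * truth_cost C (pivot_learn n (order_of s) set0) + l)%:R)).
  apply: ler_sum => s _; rewrite ler_wpM2l ?uniform_ge0 // ler_nat.
  exact: num_queries_amplify (faulty s).
under eq_bigr => s _ do rewrite natrD natrM mulrDr mulrCA.
rewrite big_split /= -mulr_sumr -mulr_suml uniform_sum1 mul1r lerD2r -natr1.
by rewrite ler_wpM2l ?sum_truth_cost_le // natr1 ler0n.
Qed.

Local Close Scope ring_scope.

Theorem theorem3 (R : realFieldType) (n l : nat) :
  (* k known: the algorithm may depend on k *)
  (forall k : nat, 1 <= k <= n ->
     exists A : rand_alg R n,
       solves k l A /\ expected_queries_le k l A (query_bound R n k l))
  /\
  (* k unknown: a single algorithm serves every k *)
  (exists A : rand_alg R n,
     forall k : nat, 1 <= k <= n ->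
       solves k l A /\ expected_queries_le k l A (query_bound R n k l)).
Proof.
(* [robust_pivot] does not take [k] as input, so it serves both the known and the unknown case. *)
have robust k := conj (@solves_robust_pivot R n k l)
  (@expected_robust_pivot R n k l).
split=> [k _|]; first by exists (robust_pivot R n l).
by exists (robust_pivot R n l) => k _.
Qed.
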